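(* Let $(d_n)_{n\ge 1}$ be a fixed sequence of integers $d_n\ge 2$. Every nega-$D$-irrational number in $[a_0-1;a_0]$ has a unique representation $\Delta^{-D}_{\varepsilon_1\varepsilon_2\ldots\varepsilon_n\ldots}$ by the alternating Cantor series. Every nega-$D$-rational number has exactly two representations by the alternating Cantor series, and there is a fixed integer $m\ge 0$ such that one of the two representations satisfies $\varepsilon_{m+2i-1}=d_{m+2i-1}-1$ and $\varepsilon_{m+2i}=0$ for all $i\in\mathbb N$, while the other satisfies $\varepsilon_{m+2i-1}=0$ and $\varepsilon_{m+2i}=d_{m+2i}-1$ for all $i\in\mathbb N$.
   Context: $\mathbb N=\{1,2,\dots\}$, $A_{d_n}=\{0,1,\dots,d_n-1\}$. For a sequence of digits $\varepsilon_n\in A_{d_n}$ put $$\Delta^{-D}_{\varepsilon_1\varepsilon_2\ldots\varepsilon_n\ldots}=\sum_{n=1}^{\infty}\frac{(-1)^n\varepsilon_n}{d_1d_2\cdots d_n}.$$ If $x$ equals this sum, the sequence $(\varepsilon_n)$ (with $\varepsilon_n\in A_{d_n}$) is called a representation of $x$ by the alternating Cantor series. Square brackets in a subscript, as in $[d_n-1]$, denote a single digit. Also $$a_0=\sum_{n=1}^{\infty}\frac{d_{2n}-1}{d_1d_2\cdots d_{2n}}=\sum_{n=1}^{\infty}\frac{(-1)^{n+1}}{d_1d_2\cdots d_n}.$$ A number $x\in[a_0-1;a_0]$ is called nega-$D$-rational if, for some $n\ge1$ and some digits $\varepsilon_1,\dots,\varepsilon_n$ with $\varepsilon_i\in A_{d_i}$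 and $\varepsilon_n\ge 1$, it can be represented as $$\Delta^{-D}_{\varepsilon_1\ldots\varepsilon_{n-1}\varepsilon_n[d_{n+1}-1]0[d_{n+3}-1]0[d_{n+5}-1]\ldots}\quad\text{or}\quad \Delta^{-D}_{\varepsilon_1\ldots\varepsilon_{n-1}[\varepsilon_n-1]0[d_{n+2}-1]0[d_{n+4}-1]0\ldots}.$$ All other numbers of $[a_0-1;a_0]$ are called nega-$D$-irrational. *)

(* Defs.v *)
From mathcomp Require Import all_boot all_order all_algebra.
From mathcomp Require Import boolp classical_sets reals topology normedtype sequences.

Set Implicit Arguments.
Unset Strict Implicit.
Unset Printing Implicit Defensive.

Import Order.TTheory GRing.Theory Num.Theory.
Import numFieldNormedType.Exports.

Local Open Scope ring_scope.

(* All sequences are indexed from 1: the value at 0 of a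
   sequence d or eps : nat -> nat is never used. *)

Definition digits (d eps : nat -> nat) : Prop :=
  forall n, (1 <= n)%N -> (eps n < d n)%N.

(* Equality of digit sequences, ignoring the meaningless index 0. *)
Definition same_digits (eps eps' : nat -> nat) : Prop :=
  forall n, (1 <= n)%N -> eps n = eps' n.

Definition dprod (R : realType) (d : nat -> nat) (n : nat) : R :=
  \prod_(1 <= i < n.+1) (d i)%:R.

(* limn is a total operator; the partial sums do converge when d n >= 2 and
   eps n < d n for n >= 1, the n-th term being at most 2 ^ (1 - n) in absolute
   value. The same bound applies to the series defining a0. *)
Definition Delta (R : realType) (d eps : nat -> nat) : R :=
  limn (fun N => \sum_(1 <= n < N) (-1) ^+ n * (eps n)%:R / dprod R d n).

Definition representation (R : realType) (d : nat -> nat) (x : R)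
    (eps : nat -> nat) : Prop :=
  digits d eps /\ x = Delta R d eps.

Definition a0 (R : realType) (d : nat -> nat) : R :=
  limn (fun N => \sum_(1 <= n < N) ((d (2 * n)%N)%:R - 1) / dprod R d (2 * n)).

(* c_1 ... c_(n-1) c_n [d_(n+1) - 1] 0 [d_(n+3) - 1] 0 ... *)
Definition rational_seq1 (d : nat -> nat) (n : nat) (c : nat -> nat) : nat -> nat :=
  fun k => if (k <= n)%N then c k
           else if odd (k - n) then (d k - 1)%N else 0%N.

(* c_1 ... c_(n-1) [c_n - 1] 0 [d_(n+2) - 1] 0 [d_(n+4) - 1] ... *)
Definition rational_seq2 (d : nat -> nat) (n : nat) (c : nat -> nat) : nat -> nat :=
  fun k => if (k < n)%N then c k
           else if k == n then (c n - 1)%N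
           else if odd (k - n) then 0%N else (d k - 1)%N.

Definition in_range (R : realType) (d : nat -> nat) (x : R) : Prop :=
  a0 R d - 1 <= x <= a0 R d.

(* Only the values c 1, ..., c n of c matter. *)
Definition negaD_rational (R : realType) (d : nat -> nat) (x : R) : Prop :=
  in_range d x /\
  exists (n : nat) (c : nat -> nat),
    [/\ (1 <= n)%N,
        forall i, (1 <= i <= n)%N -> (c i < d i)%N,
        (1 <= c n)%N
      & x = Delta R d (rational_seq1 d n c) \/ x = Delta R d (rational_seq2 d n c)].

Definition negaD_irrational (R : realType) (d : nat -> nat) (x : R) : Prop :=
  in_range d x /\ ~ negaD_rational d x.

(* Main.v *)
Require Import Defs.
From mathcomp Require Import all_boot all_order all_algebra.
From mathcomp Require Import boolp classical_sets reals topology normedtype sequences.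
From mathcomp Require Import zify ring lra.

(** Write [D n] for the product of the bases [d 1], ..., [d n]. Replacing every
    digit [e] at an odd place [n] by [d n - 1 - e] ([flip]) turns the
    alternating series into the ordinary Cantor series, the sum of the
    [delta n / D n], up to an additive constant [offset] that does not depend
    on the digits ([Delta_flip]). As the sum of all [(d n - 1) / D n] is 1, this
    constant is [1 - a0] ([a0_offset]), so that the interval from [a0 - 1] to
    [a0] becomes the unit interval ([in_range_flip]).

    For the ordinary series the facts are those known from decimal expansions.
    Every number of the unit interval has an expansion, found greedily
    ([cantor_exists]). With [P n] the [n]-th partial sum, the intervals
    from [P n] to [P n + 1 / D n] are nested and contain the sum
    ([cantor_itv]); the sum is at the left end exactly when all later digits
    vanish, and at the right end exactly when they are all maximal. Hence, if
    two distinct expansions of the same number first differ at the place [k],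
    the digits there differ by 1, the larger one is followed by zeros, and the
    smaller one by maximal digits ([cantor_two_expansions]). Consequently no
    number has three expansions ([cantor_not_three]).

    Undoing [flip], zeros and maximal digits become the two alternating tails,
    and such pairs of expansions are exactly the pairs of sequences that define
    the nega-D-rational numbers ([carry_rational_seq], [carry_rational]). *)

Import Order.TTheory GRing.Theory Num.Theory.
Import numFieldNormedType.Exports.

Section CantorSeries.
Local Open Scope ring_scope.
Local Open Scope classical_set_scope.

Variables (R : realType) (d : nat -> nat).
Hypothesis hd : forall n : nat, (1 <= n)%N -> (2 <= d n)%N.

Local Notation D := (dprod R d).

(** * Partial products *)

Lemma dprod0 : D 0%N = 1.
Proof. by rewrite /dprod big_nil. Qed.

Lemma dprodS n : D n.+1 = D n * (d n.+1)%:R.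
Proof. by rewrite /dprod big_nat_recr. Qed.

(** A crude lower bound, enough to make [1 / D n] tend to 0. *)
Lemma dprod_ge n : n.+1%:R <= D n.
Proof.
elim: n => [|n IHn]; first by rewrite dprod0.
rewrite dprodS.
have d2 : 2 <= (d n.+1)%:R :> R by rewrite ler_nat hd.
have n0 : 0 <= n%:R :> R by rewrite ler0n.
rewrite -!natr1 in IHn *.
nra.
Qed.

Lemma dprod_gt0 n : 0 < D n.
Proof. by rewrite (lt_le_trans _ (dprod_ge n)) ?ltr0n. Qed.

Lemma natr_base_neq0 n : (d n.+1)%:R != 0 :> R.
Proof. by rewrite pnatr_eq0 -lt0n (leq_trans _ (hd n.+1 isT)). Qed.

Lemma cvg_dprodV : (D n)^-1 @[n --> \oo] --> (0 : R).
Proof.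
apply: (@squeeze_cvgr _ _ _ _ (fun=> 0) harmonic); last 2 first.
- exact: cvg_cst.
- exact: cvg_harmonic.
apply: nearW => n; rewrite invr_ge0 ltW ?dprod_gt0 //=.
by rewrite lef_pV2 ?dprod_ge // posrE ?dprod_gt0 ?ltr0n.
Qed.

(** * Ordinary Cantor series *)

(** The partial sums, up to and including index [n], of the Cantor series with
    positive terms. *)
Definition csum (delta : nat -> nat) (n : nat) : R :=
  \sum_(1 <= i < n.+1) (delta i)%:R / D i.

(** The sum of the Cantor series with positive terms. *)
Definition cantor (delta : nat -> nat) : R := limn (csum delta).

Lemma csum0 delta : csum delta 0 = 0.
Proof. by rewrite /csum big_nil. Qed.

Lemma csumS delta n :
  csum delta n.+1 = csum delta n + (delta n.+1)%:R / D n.+1.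
Proof. by rewrite /csum big_nat_recr. Qed.

Lemma eq_csum delta delta' n :
  (forall i, (1 <= i <= n)%N -> delta i = delta' i) ->
  csum delta n = csum delta' n.
Proof.
by move=> e; apply: eq_big_nat => i ?; rewrite e.
Qed.

Lemma eq_cantor delta delta' :
  same_digits delta delta' -> cantor delta = cantor delta'.
Proof.
move=> e; rewrite /cantor; congr (limn _); apply: funext => n.
by apply: eq_csum => i /andP[i1 _]; exact: e.
Qed.

(** The length of an interval of rank [n], as a multiple of the next length. *)
Lemma dprodV_recl n : (D n)^-1 = (d n.+1)%:R / D n.+1.
Proof.
rewrite dprodS; have := natr_base_neq0 n; have := dprod_gt0 n.
by move=> /lt0r_neq0 ? ?; field; apply/andP.
Qed.

Lemma csum_homo delta : {homo csum delta : m n / (m <= n)%N >-> m <= n}.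
Proof.
apply/nondecreasing_seqP => n.
by rewrite csumS lerDl divr_ge0 // ltW // dprod_gt0.
Qed.

Lemma csum_top_homo delta : digits d delta ->
  {homo (fun n => csum delta n + (D n)^-1) : m n / (m <= n)%N >-> n <= m}.
Proof.
move=> dig; apply/nonincreasing_seqP => n.
rewrite csumS -addrA lerD2l (dprodV_recl n).
rewrite -[X in _ + X]mul1r -mulrDl ler_pM2r ?invr_gt0 ?dprod_gt0 //.
by rewrite natr1 ler_nat dig.
Qed.

Lemma cvg_csum delta : digits d delta ->
  csum delta @ \oo --> cantor delta.
Proof.
move=> dig; apply: nondecreasing_is_cvgn; first exact: csum_homo.
exists 1 => _ [n _ <-].
apply: (@le_trans _ _ (csum delta n + (D n)^-1)).
  by rewrite lerDl invr_ge0 ltW // dprod_gt0.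
have := csum_top_homo _ dig _ _ (leq0n n).
by rewrite csum0 dprod0 invr1 add0r.
Qed.

(** The nested intervals that locate the sum of a Cantor series. *)
Lemma cantor_itv delta n : digits d delta ->
  csum delta n <= cantor delta <= csum delta n + (D n)^-1.
Proof.
move=> dig; have cv := cvg_csum _ dig; apply/andP; split.
  apply: nondecreasing_cvgn_le; first exact: csum_homo.
  by apply/cvg_ex; exists (cantor delta).
have cvt : (fun n => csum delta n + (D n)^-1) @ \oo --> cantor delta.
  by rewrite -[X in _ --> X]addr0; apply: cvgD cv cvg_dprodV.
rewrite -[leLHS](cvg_lim _ cvt) //.
apply: (nonincreasing_cvgn_ge (csum_top_homo _ dig)).
by apply/cvg_ex; exists (cantor delta).
Qed.

Lemma cantor_eq delta y :
  (forall n, csum delta n <= y <= csum delta n + (D n)^-1) ->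
  y = cantor delta.
Proof.
move=> h; apply/esym/cvg_lim => //.
have cvy : (fun n => y - (D n)^-1) @ \oo --> y.
  rewrite -[X in _ --> X]subr0.
  by apply: cvgB cvg_dprodV; exact: cvg_cst.
apply: (@squeeze_cvgr _ _ _ _ _ (fun=> y) _ _ _ cvy); last exact: cvg_cst.
by apply: nearW => n; have /andP[-> ?] := h n; rewrite andbT lerBlDr.
Qed.

Lemma cantor_zero_tail delta k :
  (forall i, (k < i)%N -> delta i = 0%N) -> cantor delta = csum delta k.
Proof.
move=> z; apply/cvg_lim => //; rewrite -(cvg_shiftn k) /=.
apply: cvg_near_cst; apply: nearW => n.
elim: n => [|n IHn] //.
by rewrite addSn csumS IHn z ?mul0r ?addr0 // ltnS leq_addl.
Qed.

Lemma cantor_max_tail delta k :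
  (forall i, (k < i)%N -> delta i = (d i - 1)%N) ->
  cantor delta = csum delta k + (D k)^-1.
Proof.
move=> z; apply/cvg_lim => //; rewrite -(cvg_shiftn k) /=.
have cvt : (fun n => csum delta k + (D k)^-1 - (D (n + k))^-1) @ \oo
    --> csum delta k + (D k)^-1.
  rewrite -[X in _ --> X]subr0; apply: cvgB; first exact: cvg_cst.
  by rewrite (cvg_shiftn k (fun n => (D n)^-1)); exact: cvg_dprodV.
apply: cvg_trans cvt; apply: near_eq_cvg; apply: nearW => n /=.
elim: n => [|n IHn]; first by rewrite add0n addrK.
rewrite addSn csumS -IHn z ?ltnS ?leq_addl // (dprodV_recl (n + k)).
have -> : (d (n + k).+1 - 1)%:R = (d (n + k).+1)%:R - 1 :> R.
  by rewrite natrB // (leq_trans _ (hd _ _)).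
by ring.
Qed.

(** [carry k delta delta'] says that [delta] is obtained from [delta'], whose
    digits after [k] are all maximal, by carrying a unit into position [k]. *)
Definition carry (k : nat) (delta delta' : nat -> nat) : Prop :=
  [/\ (1 <= k)%N,
      forall i, (1 <= i < k)%N -> delta i = delta' i,
      delta k = (delta' k).+1,
      forall i, (k < i)%N -> delta i = 0%N
    & forall i, (k < i)%N -> delta' i = (d i - 1)%N].

Lemma carry_cantor k delta delta' :
  carry k delta delta' -> cantor delta = cantor delta'.
Proof.
case: k => [|k] [] // _ agree top z m.
rewrite (cantor_zero_tail _ _ z) (cantor_max_tail _ _ m) !csumS top -addrA.
rewrite -natr1 mulrDl mul1r; congr (_ + _).
by apply: eq_csum => i; rewrite -ltnS; exact: agree.
Qed.

Lemma cantor_zero_tail_inv delta k i : digits d delta ->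
  cantor delta = csum delta k -> (k < i)%N -> delta i = 0%N.
Proof.
move=> dig e; case: i => // i ki.
have /andP[le1 _] := cantor_itv _ i.+1 dig.
have le2 : csum delta k <= csum delta i by exact: csum_homo.
move: le1; rewrite e csumS => le1.
have : (delta i.+1)%:R / D i.+1 <= 0 by lra.
rewrite pmulr_lle0 ?invr_gt0 ?dprod_gt0 // lern0.
by move=> /eqP.
Qed.

Lemma cantor_max_tail_inv delta k i : digits d delta ->
  cantor delta = csum delta k + (D k)^-1 -> (k < i)%N ->
  delta i = (d i - 1)%N.
Proof.
move=> dig e; case: i => // i ki.
have /andP[_ le1] := cantor_itv _ i.+1 dig.
have le2 := csum_top_homo _ dig _ _ (ki : (k <= i)%N).
have := dig i.+1 isT.
move: le1; rewrite e csumS => le1.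
have : (D i)^-1 <= ((delta i.+1)%:R + 1) / D i.+1 by rewrite mulrDl mul1r; lra.
rewrite (dprodV_recl i) ler_pM2r ?invr_gt0 ?dprod_gt0 // natr1 ler_nat.
lia.
Qed.

(** The expansion that is larger at the first place where the two differ
    gains at least [1 / D k] there, and the tails can make up for at most that
    much: they do so only if both are extremal. *)
Lemma cantor_first_diff k delta delta' :
  digits d delta -> digits d delta' -> cantor delta = cantor delta' ->
  (1 <= k)%N -> (forall i, (1 <= i < k)%N -> delta i = delta' i) ->
  (delta' k < delta k)%N -> carry k delta delta'.
Proof.
move=> dig dig' e k1 agree lt.
have /andP[lo _] := cantor_itv _ k dig.
have /andP[_ hi] := cantor_itv _ k dig'.
have agree_sum : csum delta k.-1 = csum delta' k.-1.
  by apply: eq_csum => i ik; apply: agree; lia.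
have sum_k eta : csum eta k = csum eta k.-1 + (eta k)%:R / D k.
  by case: k k1 {agree lt lo hi agree_sum} => // k _; rewrite csumS.
have D0 : 0 < (D k)^-1 by rewrite invr_gt0 dprod_gt0.
have le : (delta' k)%:R + 1 <= (delta k)%:R :> R by rewrite natr1 ler_nat.
have eq_k : (delta k)%:R = (delta' k)%:R + 1 :> R.
  apply/eqP; rewrite eq_le le andbT -(ler_pM2r D0) mulrDl mul1r.
  by move: lo hi; rewrite e !sum_k agree_sum; lra.
have sums : csum delta k = csum delta' k + (D k)^-1.
  by rewrite !sum_k agree_sum eq_k mulrDl mul1r addrA.
split=> //.
- by move: eq_k; rewrite natr1 => /eqP; rewrite eqr_nat => /eqP.
- move=> i; apply: cantor_zero_tail_inv => //.
  by apply/eqP; rewrite eq_le lo andbT e sums.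
- move=> i; apply: cantor_max_tail_inv => //.
  by apply/eqP; rewrite eq_le hi -sums -e.
Qed.

Lemma cantor_two_expansions delta delta' :
  digits d delta -> digits d delta' -> cantor delta = cantor delta' ->
  ~ same_digits delta delta' ->
  exists k, carry k delta delta' \/ carry k delta' delta.
Proof.
move=> dig dig' e /existsNP diff.
have /ex_minnP[k /andP[k1 ne] kmin] :
    exists k, (1 <= k)%N && (delta k != delta' k).
  case: diff => k /not_implyP[k1 /eqP ne].
  by exists k; rewrite k1.
have agree i : (1 <= i < k)%N -> delta i = delta' i.
  move=> /andP[i1 ik]; apply/eqP; apply: contraTT ik => ni.
  by rewrite -leqNgt kmin // i1.
exists k; case: (ltngtP (delta k) (delta' k)) => lt.
- right; apply: cantor_first_diff => // i ik.
  by rewrite agree.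
- by left; apply: cantor_first_diff.
- by rewrite lt eqxx in ne.
Qed.

(** At most two expansions represent the same number: in a pair of distinct
    ones, one ends in zeros and the other in maximal digits, so that among
    three one would do both. *)
Lemma cantor_not_three delta1 delta2 delta3 :
  digits d delta1 -> digits d delta2 -> digits d delta3 ->
  cantor delta1 = cantor delta2 -> cantor delta1 = cantor delta3 ->
  ~ same_digits delta1 delta2 -> ~ same_digits delta1 delta3 ->
  same_digits delta2 delta3.
Proof.
move=> g1 g2 g3 e12 e13 n12 n13; apply: contrapT => n23.
have e23 : cantor delta2 = cantor delta3 by rewrite -e12.
have [k12 c12] := cantor_two_expansions _ _ g1 g2 e12 n12.
have [k13 c13] := cantor_two_expansions _ _ g1 g3 e13 n13.
have [k23 c23] := cantor_two_expansions _ _ g2 g3 e23 n23.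
(* Any place beyond the three carries shows the contradiction, since
   0 and [d N - 1] are different digits. *)
pose N := (k12 + k13 + k23).+1.
have d2 : (2 <= d N)%N by exact: hd.
have tails k delta delta' : carry k delta delta' -> (k < N)%N ->
    delta N = 0%N /\ delta' N = (d N - 1)%N.
  by move=> [_ _ _ z m] kN; rewrite z // m.
case: c12 => /tails [|? ?]; try by rewrite /N; lia.
all: case: c13 => /tails [|? ?]; try by rewrite /N; lia.
all: case: c23 => /tails [|? ?]; by rewrite /N; lia.
Qed.

(** Greedy digit in base [m] for the remainder [r]; the minimum only matters
    at [r = 1], where it selects the expansion with maximal digits. *)
Definition greedy_digit (m : nat) (r : R) : nat :=
  minn (Num.truncn (m%:R * r)) (m - 1).

(** The remainder after [n] greedy digits of [y], rescaled to the unit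
    interval. *)
Fixpoint greedy_rem (y : R) (n : nat) : R :=
  if n is n'.+1 then
    (d n)%:R * greedy_rem y n' - (greedy_digit (d n) (greedy_rem y n'))%:R
  else y.

(** The greedy expansion of [y]; its digits are indexed from 1, and digit [n] is
    read off from the remainder after [n - 1] digits. *)
Definition greedy (y : R) (n : nat) : nat :=
  greedy_digit (d n) (greedy_rem y n.-1).

Lemma greedy_digit_itv m r : (0 < m)%N -> 0 <= r <= 1 ->
  0 <= m%:R * r - (greedy_digit m r)%:R <= 1.
Proof.
move=> m0 /andP[r0 r1]; rewrite /greedy_digit.
have mr0 : 0 <= m%:R * r by rewrite mulr_ge0.
have /andP[lo hi] := truncn_itv mr0.
have mr : m%:R * r <= m%:R by rewrite ler_piMr.
have m1 : (m - 1)%:R = m%:R - 1 :> R by rewrite natrB.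
rewrite -natr1 in hi.
rewrite /minn; case: ltnP => h.
  by apply/andP; split; lra.
have : (m - 1)%:R <= (Num.truncn (m%:R * r))%:R :> R by rewrite ler_nat.
by rewrite m1 => ?; apply/andP; split; lra.
Qed.

Lemma greedy_rem_itv y n : 0 <= y <= 1 -> 0 <= greedy_rem y n <= 1.
Proof.
move=> y01; elim: n => [|n IHn] //=.
by apply: greedy_digit_itv => //; rewrite (leq_trans _ (hd _ _)).
Qed.

Lemma cantor_exists y : 0 <= y <= 1 ->
  exists2 delta, digits d delta & y = cantor delta.
Proof.
move=> y01; exists (greedy y).
  move=> n /hd d2; rewrite /greedy /greedy_digit.
  by rewrite (leq_ltn_trans (geq_minr _ _)) //; lia.
have expand n : y = csum (greedy y) n + greedy_rem y n * (D n)^-1.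
  elim: n => [|n IHn]; first by rewrite csum0 dprod0 invr1 add0r mulr1.
  rewrite [LHS]IHn csumS /greedy /= -addrA; congr (_ + _).
  by rewrite (dprodV_recl n); ring.
apply: cantor_eq => n.
have /andP[r0 r1] := greedy_rem_itv _ n y01.
have D0 : 0 <= (D n)^-1 by rewrite invr_ge0 ltW // dprod_gt0.
have e0 : 0 <= greedy_rem y n / D n by rewrite mulr_ge0.
have e1 : greedy_rem y n / D n <= (D n)^-1 by rewrite ler_piMl.
by have e := expand n; apply/andP; split; lra.
Qed.

(** * From alternating to ordinary series *)

(** The digitwise complement at the odd places, where the alternating series
    has its negative terms. *)
Definition flip (eps : nat -> nat) (n : nat) : nat :=
  if odd n then (d n - 1 - eps n)%N else eps n.

(** Minus the least value of the alternating series. *)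
Definition offset : R := cantor (flip (fun=> 0%N)).

Lemma digits_flip eps : digits d eps -> digits d (flip eps).
Proof.
move=> dig n n1; rewrite /flip; have := dig n n1; have := hd n n1.
by case: odd => //; lia.
Qed.

Lemma flipK eps n : digits d eps -> (1 <= n)%N -> flip (flip eps) n = eps n.
Proof.
move=> dig n1; rewrite /flip; have := dig n n1.
by case: odd => //; lia.
Qed.

Lemma same_digits_flip eps eta : digits d eps -> digits d eta ->
  same_digits (flip eps) (flip eta) -> same_digits eps eta.
Proof.
move=> dig dig' e n n1; rewrite -(flipK _ _ dig n1) -(flipK _ _ dig' n1).
by have := e n n1; rewrite /flip => ->.
Qed.

Lemma digits0 : digits d (fun=> 0%N).
Proof. by move=> n /hd; exact: leq_trans. Qed.

Lemma Delta_flip eps :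
  digits d eps -> Delta R d eps = cantor (flip eps) - offset.
Proof.
move=> dig; apply/cvg_lim => //; rewrite -cvg_shiftS /=.
have cv : (fun n => csum (flip eps) n - csum (flip (fun=> 0%N)) n) @ \oo
    --> cantor (flip eps) - offset.
  by apply: cvgB; apply/cvg_csum/digits_flip => //; exact: digits0.
apply: cvg_trans cv; apply: near_eq_cvg; apply: nearW => n /=.
rewrite /csum /= -sumrB; apply: eq_big_nat => i /andP[i1 _].
rewrite -mulrBl /flip -signr_odd; congr (_ / _).
have := dig i i1; case: odd => dgi /=; last by rewrite expr0 mul1r subr0.
by rewrite expr1 mulN1r subn0 natrB; [ring | lia].
Qed.

Lemma a0_offset : a0 R d = 1 - offset.
Proof.
apply/cvg_lim => //; rewrite -cvg_shiftS /=.
(* Of the terms [(d i - 1) / D i] with [i <= 2 n], which add up to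
   [1 - 1 / D (2 n)], the odd ones form the partial sum of [offset]. *)
have cv : (fun n => 1 - (D (2 * n))^-1 - csum (flip (fun=> 0%N)) (2 * n)) @ \oo
    --> 1 - offset.
  have dbl : (fun n => 2 * n)%N @ \oo --> \oo by exact: cvg_mulnl.
  rewrite -[X in _ --> X - _]subr0; apply: cvgB.
    by apply: cvgB; [exact: cvg_cst | exact: cvg_comp dbl cvg_dprodV].
  exact: cvg_comp dbl (cvg_csum _ (digits_flip _ digits0)).
apply: cvg_trans cv; apply: near_eq_cvg; apply: nearW => n /=.
elim: n => [|n IHn].
  by rewrite big_nil muln0 dprod0 csum0 invr1; ring.
rewrite big_nat_recr //= -IHn mulnS !add2n !csumS (dprodV_recl (2 * n)).
rewrite (dprodV_recl (2 * n).+1) /flip /= oddM /= subn0 mul0r addr0 natrB.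
  by ring.
by rewrite (leq_trans _ (hd _ _)).
Qed.

Lemma in_range_flip (x : R) : in_range d x <-> 0 <= x + offset <= 1.
Proof.
by rewrite /in_range a0_offset; split=> /andP[? ?]; apply/andP; split; lra.
Qed.

Lemma representation_flip (x : R) eps :
  representation d x eps <-> digits d eps /\ x + offset = cantor (flip eps).
Proof.
by split=> -[dig e]; split=> //; move: e; rewrite Delta_flip //; lra.
Qed.

(** * Nega-D-rational numbers and carries *)

Section RationalSequences.
Variables (n : nat) (c : nat -> nat).
Hypotheses (n1 : (1 <= n)%N) (cn1 : (1 <= c n)%N).
Hypothesis cd : forall i, (1 <= i <= n)%N -> (c i < d i)%N.

Lemma digits_rational_seq1 : digits d (rational_seq1 d n c).
Proof.
move=> k k1; rewrite /rational_seq1; have := hd k k1.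
case: (leqP k n) => kn; first by rewrite cd ?k1.
by case: odd; lia.
Qed.

Lemma digits_rational_seq2 : digits d (rational_seq2 d n c).
Proof.
move=> k k1; rewrite /rational_seq2; have := hd k k1.
case: (ltngtP k n) => kn; first by rewrite cd // k1 ltnW.
  by case: odd; lia.
by have := cd n; rewrite kn; lia.
Qed.

(** Up to exchanging the roles of the two sequences at odd [n], where a larger
    digit makes the alternating sum smaller, they are related by a carry. *)
Lemma carry_rational_seq :
  carry n (flip (rational_seq1 d n c)) (flip (rational_seq2 d n c)) \/
  carry n (flip (rational_seq2 d n c)) (flip (rational_seq1 d n c)).
Proof.
have cn : (c n < d n)%N by rewrite cd // n1 leqnn.
have agree i : (1 <= i < n)%N ->
    flip (rational_seq1 d n c) i = flip (rational_seq2 d n c) i.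
  by move=> /andP[_ h]; rewrite /flip /rational_seq1 /rational_seq2 h ltnW.
have tail i : (n < i)%N -> [/\ (i <= n)%N = false, (i < n)%N = false,
    (i == n) = false & odd (i - n) = odd i (+) odd n].
  by move=> h; rewrite oddB ?(ltnW h) //; split=> //; lia.
case on : (odd n); [right | left]; split=> //.
all: try by move=> i /agree ->.
all: try by rewrite /flip /rational_seq1 /rational_seq2 on ltnn leqnn eqxx; lia.
all: move=> i ni; have [h1 h2 h3 h4] := tail i ni.
all: rewrite /flip /rational_seq1 /rational_seq2 ?h1 ?h2 ?h3 h4 on.
all: by case: (odd i) => /=; lia.
Qed.

(** The two forms of a nega-D-rational number have the same value. *)
Lemma Delta_rational_seq :
  Delta R d (rational_seq1 d n c) = Delta R d (rational_seq2 d n c).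
Proof.
rewrite !Delta_flip; [|exact: digits_rational_seq2|exact: digits_rational_seq1].
by case: carry_rational_seq => /carry_cantor ->.
Qed.

End RationalSequences.

(** A carry between the flipped sequences makes one of the two expansions a
    [rational_seq1]: the one with the larger digit at the place [k], which is
    the second one if [k] is odd. *)
Lemma carry_rational (x : R) k eps eta : in_range d x ->
  representation d x eps -> representation d x eta ->
  carry k (flip eps) (flip eta) -> negaD_rational d x.
Proof.
move=> xr [dig xe] [dig' xe'] [k1 agree top z m].
have step c : digits d c -> x = Delta R d c -> (1 <= c k)%N ->
    (forall i, (k < i)%N -> c i = if odd (i - k) then (d i - 1)%N else 0%N) ->
    negaD_rational d x.
  move=> cdig xc ck tail; split=> //; exists k, c; split=> //.
    by move=> i /andP[i1 _]; exact: cdig.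
  left; rewrite [LHS]xc; congr (Delta R d _); apply: funext => i.
  by rewrite /rational_seq1; case: leqP => // /tail.
have dk := dig k k1; have dk' := dig' k k1.
have odd_tail i : (k < i)%N -> odd (i - k) = odd i (+) odd k.
  by move=> h; rewrite oddB // ltnW.
case ok : (odd k).
- apply: (step eta) => //.
    by move: top; rewrite /flip ok; lia.
  move=> i ki; rewrite odd_tail // ok.
  have := m i ki; have := dig' i (leq_trans k1 (ltnW ki)); rewrite /flip.
  by case: odd => /=; lia.
- apply: (step eps) => //.
    by move: top; rewrite /flip ok; lia.
  move=> i ki; rewrite odd_tail // ok.
  have := z i ki; have := dig i (leq_trans k1 (ltnW ki)); rewrite /flip.
  by case: odd => /=; lia.
Qed.

Lemma irrational_unique (x : R) : negaD_irrational d x ->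
  exists eps, representation d x eps /\
    forall eta, representation d x eta -> same_digits eta eps.
Proof.
move=> [xr irr].
have [delta dig e] := cantor_exists _ (proj1 (in_range_flip x) xr).
have rep : representation d x (flip delta).
  apply/representation_flip; split; first exact: digits_flip.
  by rewrite e; apply: eq_cantor => n n1; rewrite flipK.
exists (flip delta); split=> // eta repa.
apply: contrapT => ne; apply: irr.
have [dige ee] := proj1 (representation_flip _ _) rep.
have [diga ea] := proj1 (representation_flip _ _) repa.
have [||||k [|]] := cantor_two_expansions (flip eta) (flip (flip delta)).
- exact: digits_flip.
- exact: digits_flip.
- by rewrite -ea -ee.
- by move/(same_digits_flip _ _ diga dige).
- exact: carry_rational.
- exact: carry_rational.
Qed.

Lemma rational_two (x : R) : negaD_rational d x ->
  exists eps eps', [/\ representation d x eps, representation d x eps',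
    ~ same_digits eps eps',
    forall eta, representation d x eta ->
      same_digits eta eps \/ same_digits eta eps'
    & exists m, forall i, (1 <= i)%N ->
      [/\ eps (m + 2 * i - 1)%N = (d (m + 2 * i - 1)%N - 1)%N,
          eps (m + 2 * i)%N = 0%N,
          eps' (m + 2 * i - 1)%N = 0%N
        & eps' (m + 2 * i)%N = (d (m + 2 * i)%N - 1)%N]].
Proof.
move=> [_ [n [c [n1 cd cn1 xe]]]].
have {}xe : x = Delta R d (rational_seq1 d n c).
  by case: xe => // ->; rewrite Delta_rational_seq.
have rep1 : representation d x (rational_seq1 d n c).
  by split=> //; exact: digits_rational_seq1.
have rep2 : representation d x (rational_seq2 d n c).
  by split; [exact: digits_rational_seq2 | rewrite -Delta_rational_seq].
have ne12 : ~ same_digits (rational_seq1 d n c) (rational_seq2 d n c).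
  by move/(_ n n1); rewrite /rational_seq1 /rational_seq2 leqnn ltnn eqxx; lia.
exists (rational_seq1 d n c), (rational_seq2 d n c); split=> //.
- move=> eta rep; apply: contrapT => /not_orP[ne1 ne2]; apply: ne12.
  have [dig e] := proj1 (representation_flip _ _) rep.
  have [dig1 e1] := proj1 (representation_flip _ _) rep1.
  have [dig2 e2] := proj1 (representation_flip _ _) rep2.
  apply: same_digits_flip => //.
  apply: (cantor_not_three (flip eta)).
  all: try exact: digits_flip.
  + by rewrite -e -e1.
  + by rewrite -e -e2.
  + by move/(same_digits_flip _ _ dig dig1).
  + by move/(same_digits_flip _ _ dig dig2).
- exists n => i i1.
  have off1 : (n + 2 * i - 1 - n = (i.-1).*2.+1)%N by lia.
  have off2 : (n + 2 * i - n = i.*2)%N by lia.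
  rewrite /rational_seq1 /rational_seq2 off1 off2 /= !odd_double /=.
  have -> : (n + 2 * i - 1 <= n)%N = false by lia.
  have -> : (n + 2 * i <= n)%N = false by lia.
  have -> : (n + 2 * i - 1 < n)%N = false by lia.
  have -> : (n + 2 * i < n)%N = false by lia.
  have -> : (n + 2 * i - 1 == n)%N = false by lia.
  by have -> : (n + 2 * i == n)%N = false by lia.
Qed.

End CantorSeries.

Theorem theorem1 (R : realType) (d : nat -> nat)
    (hd : forall n : nat, (1 <= n)%N -> (2 <= d n)%N) :
  (forall x : R, negaD_irrational d x ->
     exists eps : nat -> nat,
       representation d x eps /\
       forall eta : nat -> nat, representation d x eta -> same_digits eta eps)
  /\
  (forall x : R, negaD_rational d x ->
     exists (eps eps' : nat -> nat),
       [/\ representation d x eps,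
           representation d x eps',
           ~ same_digits eps eps',
           forall eta : nat -> nat, representation d x eta ->
             same_digits eta eps \/ same_digits eta eps'
         & exists m : nat, forall i : nat, (1 <= i)%N ->
             [/\ eps (m + 2 * i - 1)%N = (d (m + 2 * i - 1)%N - 1)%N,
                 eps (m + 2 * i)%N = 0%N,
                 eps' (m + 2 * i - 1)%N = 0%N
               & eps' (m + 2 * i)%N = (d (m + 2 * i)%N - 1)%N]]).
Proof.
by split; [exact: irrational_unique | exact: rational_two].
Qed.
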